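(* Let $p$ be an odd prime. For $p\le k\le 2p-1$, in $\mathbf F_p$, $$W_k=\begin{cases}0,&k=p,\\[4pt] \dfrac{k-p}{k-p+1}\,B_{2p-1-k},&p<k<2p-1,\\[7pt] 1,&k=2p-1.\end{cases}$$
   Context: $p$ is an odd prime. The Artin--Hasse exponential is $\operatorname{AH}_p(X)=\exp\left(\sum_{i\ge0}X^{p^i}/p^i\right)=\sum_{n\ge0}u_nX^n\in\mathbf Z_p[[X]]$, $a_n\in\mathbf F_p$ is the reduction of $u_n$ modulo $p$, and $W_k=\sum_{r=0}^k(-1)^r r\,a_{rp}a_{(k-r)p}\in\mathbf F_p$. $B_n$ are the Bernoulli numbers with $B_1=-1/2$, reduced modulo $p$ (they are $p$-integral for $1\le n\le p-2$). *)

(* Defs.v *)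
From mathcomp Require Import all_boot all_order all_algebra.

Set Implicit Arguments.
Unset Strict Implicit.
Unset Printing Implicit Defensive.

Import Order.TTheory GRing.Theory Num.Theory.
Local Open Scope ring_scope.

(* A formal power series \sum_n f n X^n over the rationals is represented by
   its coefficient function f : nat -> rat. *)

(* Coefficient of X^n in exp(f) = \sum_m f^m / m`!, for a series f with
   f 0 = 0.  Since f^m is then divisible by X^m, only the terms m <= n
   contribute, and they only depend on f modulo X^n.+1. *)
Definition fps_exp (f : nat -> rat) (n : nat) : rat :=
  (\sum_(m < n.+1) (m`!)%:R^-1 *: (\poly_(j < n.+1) f j) ^+ m)`_n.

(* Coefficient of X^j in \sum_(i >= 0) X^(p^i) / p^i.  For p > 1, p ^ i = j
   forces i <= j. *)
Definition AH_log (p j : nat) : rat :=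
  \sum_(i < j.+1 | (p ^ i == j)%N) ((p ^ i)%N%:R)^-1.

Definition AH_coef (p n : nat) : rat := fps_exp (AH_log p) n.

(* ratr x is numerator over denominator, computed in 'F_p.  For p prime this
   is the reduction modulo p of x whenever p does not divide the denominator
   of x, i.e. whenever x lies in Z_p. *)
Definition reduce_mod (p : nat) (x : rat) : 'F_p := ratr x.

Definition AH_coef_mod (p n : nat) : 'F_p := reduce_mod p (AH_coef p n).

Definition W (p k : nat) : 'F_p :=
  \sum_(r < k.+1)
     (-1) ^+ r * r%:R * AH_coef_mod p (r * p) * AH_coef_mod p ((k - r) * p).

(* The list [:: B_0; ...; B_(n-1)], built with the recursion
   \sum_(j <= m) 'C(m.+1, j) B_j = 0 for m > 0 (see bernoulli_sum). *)
Fixpoint bernoulli_seq (n : nat) : seq rat :=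
  if n is m.+1 then
    let s := bernoulli_seq m in
    rcons s (((m == 0)%N%:R - \sum_(j < m) 'C(m.+1, j)%:R * s`_j) / m.+1%:R)
  else [::].

Definition bernoulli (n : nat) : rat := (bernoulli_seq n.+1)`_n.

Lemma size_bernoulli_seq n : size (bernoulli_seq n) = n.
Proof. by elim: n => //= n IHn; rewrite size_rcons IHn. Qed.

Lemma nth_bernoulli_seq n j : (j < n)%N -> (bernoulli_seq n)`_j = bernoulli j.
Proof.
elim: n => // n IHn; rewrite ltnS leq_eqVlt => /predU1P[->//|ltjn].
by rewrite [bernoulli_seq _]/= nth_rcons size_bernoulli_seq ltjn IHn.
Qed.

Lemma bernoulli_sum n :
  \sum_(j < n.+1) 'C(n.+1, j)%:R * bernoulli j = (n == 0)%N%:R.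
Proof.
rewrite big_ord_recr /= binSn {2}/bernoulli [bernoulli_seq _]/=.
rewrite nth_rcons size_bernoulli_seq ltnn eqxx.
rewrite mulrC divfK ?pnatr_eq0 // [X in _ + (_ - X)](_ : _ =
  \sum_(j < n) 'C(n.+1, j)%:R * bernoulli j) ?subrKC //.
by apply: eq_bigr => j _; rewrite nth_bernoulli_seq.
Qed.

Lemma bernoulli1 : bernoulli 1 = - 2%:R^-1.
Proof.
have := bernoulli_sum 0; have := bernoulli_sum 1.
rewrite !big_ord_recr !big_ord0 /= !add0r bin0 bin1 !mul1r => + B0.
by rewrite B0 => /eqP; rewrite addrC addr_eq0 => /eqP /(canRL (mulKf _)) ->;
  rewrite ?mulrN1 ?pnatr_eq0.
Qed.

(* Main.v *)
Require Import Defs.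
From HB Require Import structures.
From mathcomp Require Import all_boot all_order all_algebra all_field ring zify.

Set Implicit Arguments.
Unset Strict Implicit.
Unset Printing Implicit Defensive.

Import Order.TTheory GRing.Theory Num.Theory.
Local Open Scope ring_scope.

(** Write u_n for the Artin-Hasse coefficients, S for the sum of the X^(p^i),
    theta for the operator X d/dX, and A(T) for the series of the u_(rp) T^r.
    Since theta(AH) = S AH, reading this equation on the residue classes of the
    exponents modulo p gives, with L(T) = T + T^p + T^(p^2) + ..., the exact
    identity
      (p theta - L - (p-1)) ... (p theta - L - 1) (p theta - L) A = T A.
    The equation modulo p alone says nothing about A; everything comes from
    this identity modulo p^2.  To first order in p the product of operators is
    a Taylor expansion of the falling factorial q(y) = y (y-1) ... (y-p+1) at
    y = - L (psect_expand): it sends A to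
      q(-L) A + p q'(-L) theta(A) + p q''(-L)/2 theta(-L) A   modulo p^2.
    Now q = X^p - X + p rho with rho integral, so q' = -1 and q'' = 0 modulo p,
    and the identity becomes, modulo p and T^(2p),
      theta(A) = (rho(-L) - T^(2p-1)) A                          (psect_ode).

    The series of the W_k is (theta A)(-T) A(T), hence it equals
    (rho(L) + T^(2p-1)) A(T) A(-T).  The identity rho(x) + rho(-x) = x^(p-1)
    modulo p (ffremF_opp) turns the differential equation of A into
    theta(b) = L^(p-1) b for the even series b = A(T) A(-T); as theta kills
    T^p, this determines b once its coefficient at T^p is known, and that one
    vanishes by parity.  So b = 1 - T^(p-1) + T^(2p-2) modulo T^(2p)
    (refl_prodE), and multiplying out gives
      W_k = (k-p) rho_(k-p+1) + [k = 2p-1]      for p <= k < 2p.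

    The coefficients of rho are Stirling numbers divided by p.  The equation
    x (q(x) - q(x-1)) = p q(x) makes x^(p-1) + rho'(x), modulo p, a polynomial
    whose backward difference is - x^(p-2), as for a Bernoulli polynomial of
    degree p-1.  Read on coefficients it is the Bernoulli recursion, so that
    m rho_m = B_(p-m) modulo p for 2 <= m < p (bernoulli_modE).

    All this needs u_n to be p-integral.  That is Dwork's argument:
    AH(X)^p = AH(X^p) exp(pX), where exp(pX) = 1 modulo p and f(X)^p = f(X^p)
    modulo p, so p u_n is divisible by p as soon as the smaller coefficients
    are integral (AH_coef_loc). *)

(** * Polynomials modulo a power of the variable *)

(** Equality modulo X^N.  Power series are handled through polynomial
    truncations, the coefficients from N on being irrelevant. *)
Definition eqX (R : nzRingType) (N : nat) (f g : {poly R}) : Prop :=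
  forall i, (i < N)%N -> f`_i = g`_i.

Section EqX.
Variables (R : nzRingType) (N : nat).
Implicit Types f g h : {poly R}.

Lemma eqX_refl f : eqX N f f. Proof. by []. Qed.

Lemma eqX_eq f g : f = g -> eqX N f g. Proof. by move=> ->. Qed.

Lemma eqX_sym f g : eqX N f g -> eqX N g f.
Proof. by move=> fg i /fg ->. Qed.

Lemma eqX_trans g f h : eqX N f g -> eqX N g h -> eqX N f h.
Proof. by move=> fg gh i iN; rewrite fg ?gh. Qed.

Lemma eqXD f1 f2 g1 g2 :
  eqX N f1 g1 -> eqX N f2 g2 -> eqX N (f1 + f2) (g1 + g2).
Proof. by move=> e1 e2 i iN; rewrite !coefD e1 ?e2. Qed.

Lemma eqXN f g : eqX N f g -> eqX N (- f) (- g).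
Proof. by move=> e i iN; rewrite !coefN e. Qed.

Lemma eqXM f1 f2 g1 g2 :
  eqX N f1 g1 -> eqX N f2 g2 -> eqX N (f1 * f2) (g1 * g2).
Proof.
move=> e1 e2 i iN; rewrite !coefM; apply: eq_bigr => j _.
have ji : (j <= i)%N by rewrite -ltnS.
by rewrite e1 ?e2 // ?(leq_ltn_trans ji iN) // (leq_ltn_trans (leq_subr _ _) iN).
Qed.

Lemma eqXX f g n : eqX N f g -> eqX N (f ^+ n) (g ^+ n).
Proof. by move=> e; elim: n => // n IHn; rewrite !exprS; apply: eqXM. Qed.

Lemma eqX_sum (I : Type) (r : seq I) (F G : I -> {poly R}) :
  (forall i, eqX N (F i) (G i)) ->
  eqX N (\sum_(i <- r) F i) (\sum_(i <- r) G i).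
Proof. by move=> e i iN; rewrite !coef_sum; apply: eq_bigr => j _; apply: e. Qed.

Lemma eqXXn0 n f : (N <= n)%N -> eqX N ('X^n * f) 0.
Proof. by move=> Nn i iN; rewrite coefXnM coef0 (leq_trans iN Nn). Qed.

End EqX.

Lemma eqX_map (R S : nzRingType) (h : {rmorphism R -> S}) N (f g : {poly R}) :
  eqX N f g -> eqX N (map_poly h f) (map_poly h g).
Proof. by move=> e i iN; rewrite !coef_map e. Qed.

(** The hypothesis on y makes y^N divisible by X^N. *)
Lemma eqX_comp (R : comNzRingType) N (f g y : {poly R}) :
  y`_0 = 0 -> eqX N f g -> eqX N (f \Po y) (g \Po y).
Proof.
move=> y0 e.
have [z ->] : exists z, y = z * 'X.
  have : root y 0 by rewrite /root horner_coef0 y0.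
  by case/factor_theorem => z ->; exists z; rewrite subr0.
have E : f = g + 'X^N * drop_poly N (f - g).
  have : take_poly N (f - g) = 0.
    apply/polyP=> i; rewrite coef_take_poly coef0; case: ifP => // iN.
    by rewrite coefB e // subrr.
  move=> t0; have := poly_take_drop N (f - g); rewrite t0 add0r mulrC => ->.
  by rewrite addrC subrK.
move=> i iN; rewrite {1}E comp_polyD comp_polyM comp_Xn_poly exprMn_comm; last first.
  exact: mulrC.
by rewrite (mulrC (z ^+ N)) -mulrA coefD coefXnM iN addr0.
Qed.

Section Theta.
Variable R : comNzRingType.
Implicit Types f g y : {poly R}.

(** The derivation X d/dX.  Unlike d/dX it does not lower degrees, so it is
    compatible with truncation. *)
Definition theta f : {poly R} := 'X * f^`().

Lemma coef_theta f i : (theta f)`_i = i%:R * f`_i.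
Proof.
rewrite coefXM coef_deriv; case: i => [|i] /=; first by rewrite mul0r.
by rewrite mulr_natl.
Qed.

Lemma thetaD f g : theta (f + g) = theta f + theta g.
Proof. by rewrite /theta derivD mulrDr. Qed.

Lemma thetaM f g : theta (f * g) = theta f * g + f * theta g.
Proof. by rewrite /theta derivM; ring. Qed.

Lemma theta_natM n f : theta (n%:R * f) = n%:R * theta f.
Proof. by rewrite /theta -[n%:R]polyC_natr mul_polyC derivZ -mul_polyC; ring. Qed.

Lemma theta_comp f y : theta (f \Po y) = (f^`() \Po y) * theta y.
Proof. by rewrite /theta deriv_comp; ring. Qed.

Lemma theta_exp f n : theta (f ^+ n) = n%:R * f ^+ n.-1 * theta f.
Proof. by rewrite /theta deriv_exp -mulr_natl; ring. Qed.

Lemma eqX_theta N f g : eqX N f g -> eqX N (theta f) (theta g).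
Proof. by move=> e i iN; rewrite !coef_theta e. Qed.

End Theta.

Lemma theta_map (R S : comNzRingType) (h : {rmorphism R -> S}) (f : {poly R}) :
  map_poly h (theta f) = theta (map_poly h f).
Proof. by rewrite /theta rmorphM /= map_polyX deriv_map. Qed.

(** In characteristic 0 the coefficient of X^i in theta f = K f expresses
    i f_i through the f_j with j < i, because K has no constant term. *)
Lemma eqX_ode_uniq (R : numDomainType) N (K f g : {poly R}) :
  K`_0 = 0 -> f`_0 = g`_0 ->
  eqX N (theta f) (K * f) -> eqX N (theta g) (K * g) -> eqX N f g.
Proof.
move=> K0 fg0 ef eg.
elim/ltn_ind=> -[|i] IHi iN //.
apply: (mulfI (_ : i.+1%:R != 0)); first by rewrite pnatr_eq0.
rewrite -!coef_theta ef // eg // !coefM; apply: eq_bigr => -[[|j] /= ji] _.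
  by rewrite K0 !mul0r.
have ij : (i - j < i.+1)%N by rewrite ltnS leq_subr.
by rewrite subSS IHi // (ltn_trans ij iN).
Qed.

(** * Exponentials of formal power series *)

Section FpsExp.
Variable f : nat -> rat.
Hypothesis f0 : f 0 = 0.

Let trunc n : {poly rat} := \poly_(j < n) f j.
Let expsum n N : {poly rat} := \sum_(m < n) (m`!)%:R^-1 *: trunc N ^+ m.

(** The definition of fps_exp uses, for each coefficient, its own truncations of
    the series and of the exponential sum.  Any larger ones give the same
    coefficient, so a single polynomial serves for all of them. *)
Lemma fps_exp_stable n N i : (i < n)%N -> (i < N)%N ->
  (expsum n N)`_i = fps_exp f i.
Proof.
move=> lin liN; rewrite /fps_exp /expsum !coef_sum.
rewrite [RHS](big_ord_widen n (fun m => ((m`!)%:R^-1 *: trunc i.+1 ^+ m)`_i)) //.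
rewrite [RHS]big_mkcond /=; apply: eq_bigr => m _.
case: ltnP => mi; last first.
  have [g ->] : exists g, trunc N = g * 'X.
    have : root (trunc N) 0.
      by rewrite /root horner_coef0 coef_poly; case: ifP => // _; rewrite f0.
    by case/factor_theorem => z ->; exists z; rewrite subr0.
  by rewrite exprMn_comm ?coefZ ?coefMXn ?mi ?coef0 ?mulr0 //; apply: mulrC.
rewrite !coefZ; congr (_ * _).
apply: (@eqXX _ i.+1) => // j ji.
by rewrite !coef_poly ji (leq_trans ji).
Qed.

Lemma fps_exp0 : fps_exp f 0 = 1.
Proof. by rewrite /fps_exp big_ord1 expr0 fact0 invr1 scale1r coef1. Qed.

(** theta (exp f) = theta f * exp f, coefficientwise. *)
Lemma fps_exp_rec n :
  n%:R * fps_exp f n = \sum_(j < n.+1) j%:R * f j * fps_exp f (n - j).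
Proof.
case: n => [|n]; first by rewrite big_ord1 !mul0r.
rewrite -(@fps_exp_stable n.+2 n.+2 n.+1) //.
rewrite -coef_theta /theta /expsum raddf_sum big_ord_recl /= expr0 derivZ derivC scaler0 add0r.
have -> : \sum_(i < n.+1) ((lift ord0 i)`!%:R^-1 *: trunc n.+2 ^+ lift ord0 i)^`()
    = (trunc n.+2)^`() * expsum n.+1 n.+2.
  rewrite mulr_sumr; apply: eq_bigr => i _; rewrite lift0 derivZ deriv_exp /=.
  rewrite -scaler_nat scalerA factS natrM invfM mulrAC mulVf ?pnatr_eq0 //.
  by rewrite mul1r scalerAr.
rewrite mulrA -/(theta _) coefM.
rewrite big_ord_recl [RHS]big_ord_recl !coef_theta !mul0r !add0r; apply: eq_bigr => i _.
have i_n : (i < n.+1)%N by [].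
rewrite coef_theta lift0 coef_poly ltnS i_n; congr (_ * _).
by rewrite fps_exp_stable // subSS ltnS ?leq_subr // (leq_trans (leq_subr _ _)).
Qed.
End FpsExp.

(** * The local ring of rationals that reduce into a field *)

Section Local.
Variable F : fieldType.

(** For F = 'F_p these are the p-integral rationals.  Phrasing the condition
    through F makes ratr a ring morphism to F with no primality assumption, so
    that the ring structures below can be inferred canonically. *)
Definition loc_pred : {pred rat} := fun x => (denq x)%:~R != 0 :> F.

(** Membership and reduction can be read on any representation of x as a
    fraction m / d, not only on the reduced one: the reduced denominator
    divides d. *)
Lemma ratr_loc_frac (x : rat) (d m : int) :
  d%:~R != 0 :> F -> x * d%:~R = m%:~R ->
  (x \in loc_pred) /\ ratr x = m%:~R / d%:~R :> F.
Proof.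
move=> d0 xd.
have E : numq x * d = m * denq x.
  by apply: (@intr_inj rat); rewrite !rmorphM /= -xd numqE; ring.
have dvd : (denq x %| d)%Z.
  have : (denq x %| numq x * d)%Z by rewrite E dvdz_mull.
  by rewrite Gauss_dvdzr // coprimez_sym coprimezE coprime_num_den.
have den0 : (denq x)%:~R != 0 :> F.
  by case/dvdzP: dvd d0 => c ->; rewrite rmorphM mulf_eq0 negb_or => /andP[].
split=> //; apply/eqP; rewrite /ratr eqr_div //.
by rewrite -!rmorphM /= E.
Qed.

Lemma ratr_loc_int (m : int) : (m%:~R \in loc_pred) /\ ratr m%:~R = m%:~R :> F.
Proof.
have := @ratr_loc_frac m%:~R 1 m; rewrite !mulr1 divr1 => h.
by apply: h; rewrite ?oner_neq0.
Qed.

Lemma ratr_locD x y : x \in loc_pred -> y \in loc_pred ->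
  (x + y \in loc_pred) /\ ratr (x + y) = ratr x + ratr y :> F.
Proof.
move=> xl yl; have x0 : (denq x)%:~R != 0 :> F := xl.
have y0 : (denq y)%:~R != 0 :> F := yl.
have := @ratr_loc_frac (x + y) (denq x * denq y) (numq x * denq y + numq y * denq x).
rewrite /ratr (addf_div _ _ x0 y0) !rmorphD !rmorphM /=; apply.
  by rewrite mulf_neq0.
by rewrite !numqE; ring.
Qed.

Lemma ratr_locM x y : x \in loc_pred -> y \in loc_pred ->
  (x * y \in loc_pred) /\ ratr (x * y) = ratr x * ratr y :> F.
Proof.
move=> xl yl; have x0 : (denq x)%:~R != 0 :> F := xl.
have y0 : (denq y)%:~R != 0 :> F := yl.
have := @ratr_loc_frac (x * y) (denq x * denq y) (numq x * numq y).
rewrite /ratr mulf_div !rmorphM /=; apply.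
  by rewrite mulf_neq0.
by rewrite !numqE; ring.
Qed.

Lemma loc_subring : subring_closed loc_pred.
Proof.
split; first by have [] := ratr_loc_int 1.
  move=> x y xl yl.
  have [/= h _] := ratr_loc_int (-1); have [h2 _] := ratr_locM h yl.
  by have [] := ratr_locD xl h2; rewrite mulN1r.
by move=> x y xl yl; have [] := ratr_locM xl yl.
Qed.
HB.instance Definition _ := GRing.isSubringClosed.Build rat loc_pred loc_subring.

Record loc := Loc { loc_val : rat; locP : loc_val \in loc_pred }.
HB.instance Definition _ := [isSub for loc_val].
HB.instance Definition _ := [Choice of loc by <:].
HB.instance Definition _ := [SubChoice_isSubComNzRing of loc by <:].

Definition loc_red (x : loc) : F := ratr (val x).

Lemma loc_red_is_zmod_morphism : zmod_morphism loc_red.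
Proof.
move=> x y; have [h hr] := ratr_loc_int (-1).
have [h2 h2r] := ratr_locM h (valP y).
have [_] := ratr_locD (valP x) h2.
by rewrite /loc_red rmorphB /= h2r hr !mulrN1z !mulN1r.
Qed.

Lemma loc_red_is_monoid_morphism : monoid_morphism loc_red.
Proof.
split; first by have [_] := ratr_loc_int 1.
by move=> x y; have [_] := ratr_locM (valP x) (valP y).
Qed.
HB.instance Definition _ :=
  GRing.isZmodMorphism.Build loc F loc_red loc_red_is_zmod_morphism.
HB.instance Definition _ :=
  GRing.isMonoidMorphism.Build loc F loc_red loc_red_is_monoid_morphism.

(** A total function, so that sequences of rationals can be lifted before they
    are known to be integral; non-integral values are sent to 0. *)
Definition to_loc (x : rat) : loc := insubd (0 : loc) x.

Lemma to_locK x : x \in loc_pred -> val (to_loc x) = x.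
Proof. by move=> xl; rewrite insubdK. Qed.

Lemma loc_natV n : n%:R != 0 :> F -> (n%:R : rat)^-1 \in loc_pred.
Proof.
move=> n0; have q0 : (n%:R : rat) != 0.
  by rewrite pnatr_eq0; apply: contraNneq n0 => ->.
by have [] := @ratr_loc_frac n%:R^-1 n 1 n0 (mulVf q0).
Qed.

Lemma loc_lreg n : (0 < n)%N -> GRing.lreg (n%:R : loc).
Proof.
move=> n0 x y /(congr1 val); rewrite !rmorphM rmorph_nat => /mulfI e.
by apply/val_inj/e; rewrite pnatr_eq0 -lt0n.
Qed.

(** The kernel of the reduction is generated by p.  This is how congruences
    modulo p, proved in F, are brought back to characteristic 0. *)
Lemma loc_red_eq0 p (x : loc) : p \in [pchar F] -> loc_red x = 0 ->
  exists y, x = p%:R * y.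
Proof.
move=> chp x0; have p0 : (p%:R : rat) != 0.
  by rewrite pnatr_eq0 -lt0n prime_gt0 // (pcharf_prime chp).
have d0 : (denq (val x))%:~R != 0 :> F := valP x.
have n0 : (numq (val x))%:~R = 0 :> F.
  by move/eqP: x0; rewrite mulf_eq0 invr_eq0 (negPf d0) orbF => /eqP.
have /dvdzP [c nc] : (p %| numq (val x))%Z by rewrite (dvdz_pcharf chp) n0.
have xd : val x / p%:R * (denq (val x))%:~R = c%:~R.
  by rewrite mulrAC -numqE nc rmorphM mulfK.
have [cl _] := ratr_loc_frac d0 xd.
exists (to_loc (val x / p%:R)); apply/val_inj.
by rewrite rmorphM rmorph_nat; have /= -> := to_locK cl; rewrite mulrC divfK.
Qed.

End Local.

(** * The Artin-Hasse recurrence and Dwork's identity *)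

(** The coefficients of theta applied to the Artin-Hasse logarithm, by
    AH_logE. *)
Definition ppow (p j : nat) : bool := [exists i : 'I_j.+1, (p ^ i == j)%N].

Lemma ppowP p j : (1 < p)%N -> reflect (exists i, (p ^ i = j)%N) (ppow p j).
Proof.
move=> p1; apply: (iffP existsP) => [[i /eqP <-]|[i <-]]; first by exists i.
have lt_i : (i < (p ^ i).+1)%N by rewrite ltnS ltnW // ltn_expl.
by exists (Ordinal lt_i) => /=.
Qed.

Lemma AH_logE p j : (1 < p)%N -> j%:R * AH_log p j = (ppow p j)%:R.
Proof.
move=> p1; rewrite /AH_log; case: (ppowP j p1) => // [[i ij]|nj]; last first.
  rewrite big_pred0 ?mulr0 // => i; apply/negbTE/eqP=> ij.
  by apply: nj; exists i.
have lt_i : (i < j.+1)%N by rewrite ltnS -ij ltnW // ltn_expl.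
rewrite (big_pred1 (Ordinal lt_i)) => [|k /=]; last first.
  by rewrite -val_eqE /= -(eqn_exp2l k i p1) ij.
by rewrite ij mulfV // pnatr_eq0 -lt0n -ij expn_gt0 ltnW.
Qed.

Lemma ppow0 p : (1 < p)%N -> ppow p 0 = false.
Proof.
by move=> p1; apply/(ppowP _ p1) => -[i /eqP]; rewrite expn_eq0; case: p p1.
Qed.

Lemma ppow_mulp p j : (1 < p)%N -> ppow p (p * j) = ppow p j.
Proof.
move=> p1; apply/(ppowP _ p1)/(ppowP _ p1) => -[i]; last first.
  by move=> ij; exists i.+1; rewrite expnS ij.
case: i => [|i] /eqP.
  rewrite expn0 eq_sym muln_eq1 => /andP[/eqP p_1]; by rewrite p_1 in p1.
by rewrite expnS eqn_pmul2l ?(ltnW p1) // => /eqP; exists i.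
Qed.

Lemma ppow_ndiv p j : (1 < p)%N -> ~~ (p %| j)%N -> ppow p j = (j == 1%N).
Proof.
move=> p1 pj; apply/(ppowP _ p1)/eqP => [[[|i]]|->]; last by exists 0%N.
  by rewrite expn0.
by move=> ji; rewrite -ji expnS dvdn_mulr in pj.
Qed.

Lemma AH_coef0 p : AH_coef p 0 = 1.
Proof. exact: fps_exp0. Qed.

Lemma AH_log0 p : AH_log p 0 = 0.
Proof. by rewrite /AH_log big_pred0 // => i; rewrite ord1. Qed.

(** theta AH = (X + X^p + X^(p^2) + ...) AH, coefficientwise. *)
Lemma AH_rec p n : (1 < p)%N ->
  n%:R * AH_coef p n = \sum_(j < n.+1) (ppow p j)%:R * AH_coef p (n - j).
Proof.
move=> p1; rewrite /AH_coef fps_exp_rec ?AH_log0 //.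
by apply: eq_bigr => j _; rewrite AH_logE.
Qed.

(** In Legendre's formula, the sum of the (m+1) %/ p^k is its first term
    a <= (m+1) / 2 plus the same sum for a, which is less than a unless
    a = 0. *)
Lemma logn_fact_lt p m : prime p -> (logn p m.+1`! <= m)%N.
Proof.
move=> p_pr; rewrite logn_fact //; move: (m.+2) => K; elim: K m => [|K IHK] m.
  by rewrite big_geq.
case: K IHK => [|K] IHK; first by rewrite big_geq.
rewrite big_nat_recl // expn1.
have half : ((m.+1 %/ p).*2 <= m.+1)%N.
  by rewrite -muln2 (leq_trans _ (leq_divM m.+1 p)) // leq_mul2l prime_gt1 ?orbT.
under eq_bigr => k _ do rewrite expnS divnMA.
case: (m.+1 %/ p)%N half => [_|a half].
  by rewrite add0n big1 // => k _; rewrite div0n.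
have := IHK a; rewrite big_add1 /= => IH.
by rewrite (leq_trans (leq_add (leqnn _) IH)) // addSn addnn -ltnS -doubleS.
Qed.

(** That is, exp(pX) = 1 modulo p: its coefficient of degree m+1 is p times
    this integral number. *)
Lemma loc_exp_fact p m : prime p ->
  (p%:R ^+ m / (m.+1)`!%:R : rat) \in loc_pred 'F_p.
Proof.
move=> p_pr; have lem := logn_fact_lt m p_pr.
have fp : (0 < m.+1`!)%N := fact_gt0 _.
set v := logn _ _ in lem.
have E : (m.+1`! = p ^ v * (m.+1`!)`_p^')%N.
  by rewrite -p_part partnC.
have p0 : (p%:R : rat) != 0 by rewrite pnatr_eq0 -lt0n prime_gt0.
have -> : p%:R ^+ m / (m.+1)`!%:R = p%:R ^+ (m - v) / ((m.+1`!)`_p^')%:R :> rat.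
  rewrite {1}E natrM natrX invfM mulrA; congr (_ / _).
  by rewrite -{1}(subnK lem) exprD mulfK // expf_neq0.
rewrite rpredM ?rpredX ?rpred_nat //.
apply: loc_natV; rewrite -(dvdn_pcharf (pchar_Fp p_pr)).
by rewrite -prime_coprime // (@pnat_coprime p) ?pnat_id ?part_pnat.
Qed.

Section Dwork.
Variables (p n : nat).
Hypothesis p_pr : prime p.
Let p1 : (1 < p)%N := prime_gt1 p_pr.
Let U : {poly rat} := \poly_(i < n.+1) AH_coef p i.
Let K : {poly rat} := \poly_(i < n.+1) (ppow p i)%:R.
Let e : {poly rat} := \poly_(i < n.+1) (p%:R ^+ i / i`!%:R).

Lemma theta_AH_trunc : eqX n.+1 (theta U) (K * U).
Proof.
move=> i iN; rewrite coef_theta coefM coef_poly iN AH_rec //.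
apply: eq_bigr => j _; rewrite !coef_poly.
have ji : (j <= i)%N by rewrite -ltnS.
by rewrite (leq_ltn_trans ji iN) (leq_ltn_trans (leq_subr _ _) iN).
Qed.

Lemma theta_exp_trunc : eqX n.+1 (theta e) (p%:R * 'X * e).
Proof.
move=> i iN; rewrite coef_theta -mulrA -polyC_natr coefCM coefXM !coef_poly iN.
case: i iN => [|i] iN /=; first by rewrite mul0r mulr0.
rewrite (ltnW iN) factS natrM exprS invfM.
by rewrite mulrCA mulVKf ?pnatr_eq0 // mulrA.
Qed.

(** The exponents p^i with i > 0 are the p p^j: substituting X^p in the sum of
    the X^(p^i) only loses the term X. *)
Lemma ppow_comp_Xp : eqX n.+1 (K \Po 'X^p) (K - 'X).
Proof.
move=> i iN; rewrite coef_comp_poly_Xn ?(ltnW p1) // coefB coefX !coef_poly iN.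
case: ifP => pi; last first.
  by rewrite ppow_ndiv ?pi // subrr.
rewrite (leq_ltn_trans (leq_div _ _) iN) -ppow_mulp // mulnC divnK //.
by case: eqP pi => [->|_]; rewrite ?subr0 // dvdn1 gtn_eqF.
Qed.

(** Both sides have constant term 1 and satisfy theta f = p K f; on the right
    the factor exp(pX) contributes the term pX that K(X^p) lacks. *)
Lemma AH_dwork : eqX n.+1 (U ^+ p) ((U \Po 'X^p) * e).
Proof.
apply: (@eqX_ode_uniq _ _ (p%:R * K)).
- by rewrite -polyC_natr coefCM coef_poly ppow0 // mulr0.
- rewrite -!horner_coef0 hornerM horner_comp hornerXn horner_exp !horner_coef0.
  rewrite !coef_poly /= AH_coef0 expr1n.
  rewrite expr0n gtn_eqF ?(ltnW p1) //= horner_coef0 coef_poly /= AH_coef0.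
  by rewrite fact0 expr0 divr1.
- rewrite theta_exp.
  apply: (@eqX_trans _ _ (p%:R * U ^+ p.-1 * (K * U))).
    exact/eqXM/theta_AH_trunc/eqX_refl.
  by rewrite -[in U ^+ p](prednK (ltnW p1)) exprS; apply: eqX_eq; ring.
rewrite thetaM.
apply: (@eqX_trans _ _ (p%:R * (K - 'X) * (U \Po 'X^p) * e + (U \Po 'X^p) * (p%:R * 'X * e))).
  apply/eqXD/eqXM/theta_exp_trunc/eqX_refl; apply/eqXM/eqX_refl.
  have -> : theta (U \Po 'X^p) = p%:R * (theta U \Po 'X^p).
    rewrite theta_comp /theta derivXn comp_polyM comp_polyX -mulr_natl.
    by rewrite -[in 'X^p](prednK (ltnW p1)) exprS; ring.
  apply: (@eqX_trans _ _ (p%:R * ((K * U) \Po 'X^p))).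
    apply/eqXM/eqX_comp/theta_AH_trunc; first exact: eqX_refl.
    by rewrite coefXn ltn_eqF ?(ltnW p1).
  rewrite comp_polyM mulrA -!(mulrA p%:R).
  by apply/eqXM/eqXM/eqX_refl/ppow_comp_Xp; apply: eqX_refl.
by apply: eqX_eq; ring.
Qed.
End Dwork.

(** * Integrality of the Artin-Hasse coefficients *)

(** The Frobenius is additive in characteristic p, and it fixes 'F_p. *)
Lemma Fp_poly_expp p (f : {poly 'F_p}) : prime p -> f ^+ p = f \Po 'X^p.
Proof.
move=> p_pr; have chF := pchar_Fp p_pr.
have chP : p \in [pchar {poly 'F_p}].
  by rewrite (rmorph_pchar (@polyC 'F_p)).
elim/poly_ind: f => [|f c IHf].
  by rewrite comp_poly0 expr0n gtn_eqF ?prime_gt0.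
rewrite comp_polyD comp_polyM comp_polyX comp_polyC -IHf.
rewrite exprDn_pchar; last by rewrite pnatE.
rewrite exprMn -polyC_exp; congr (_ + _%:P).
by have := expf_card c; rewrite card_Fp.
Qed.

Lemma eqX_expD_mulXn (R : comNzRingType) n m (f : {poly R}) (c : R) :
  (0 < n)%N -> f`_0 = 1 ->
  eqX n.+1 ((f + c *: 'X^n) ^+ m) (f ^+ m + (m%:R * c) *: 'X^n).
Proof.
move=> n_gt0 f0; elim: m => [|m IHm].
  by rewrite !expr0 mul0r scale0r addr0.
rewrite exprS; apply: eqX_trans (eqXM (@eqX_refl _ _ _) IHm) _.
have fm0 : (f ^+ m)`_0 = 1.
  by rewrite -horner_coef0 horner_exp horner_coef0 f0 expr1n.
set a := m%:R * c.
have -> : (f + c *: 'X^n) * (f ^+ m + a *: 'X^n) =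
    f ^+ m.+1 + 'X^n * (c%:P * f ^+ m + a%:P * f + (c * a)%:P * 'X^n).
  by rewrite -!mul_polyC exprS (polyCM c a); ring.
move=> i iN; rewrite !coefD coefZ coefXnM coefXn.
move: iN; rewrite ltnS leq_eqVlt => /predU1P[->|i_n]; last first.
  by rewrite i_n (ltn_eqF i_n) mulr0.
rewrite ltnn eqxx mulr1 subnn !coefD !coefCM coefXn f0 fm0 ltn_eqF //= /a -natr1.
by ring.
Qed.

(** Strong induction.  In the coefficient of X^n of Dwork's identity, u_n only
    occurs in AH^p, through the term p u_n: on the other side u_i comes with
    X^(ip), and ip <= n forces i < n.  The rest of that coefficient is
    divisible by p, by the Frobenius congruence and loc_exp_fact. *)
Lemma AH_coef_loc p n : prime p -> AH_coef p n \in loc_pred 'F_p.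
Proof.
move=> p_pr; have p1 := prime_gt1 p_pr.
have chF := pchar_Fp p_pr.
have p0 : (p%:R : rat) != 0 by rewrite pnatr_eq0 -lt0n prime_gt0.
elim/ltn_ind: n => -[|n'] IHn; first by rewrite AH_coef0 rpred1.
set n := n'.+1 in IHn *.
pose P0 : {poly loc 'F_p} := \poly_(i < n) to_loc 'F_p (AH_coef p i).
pose U0 : {poly rat} := map_poly val P0.
have U0E i : U0`_i = if (i < n)%N then AH_coef p i else 0.
  rewrite coef_map coef_poly; case: ifP => ni //.
  by have /= -> := to_locK (IHn _ ni).
have [z Ez] : exists z : loc 'F_p, (P0 ^+ p)`_n - (P0 \Po 'X^p)`_n = p%:R * z.
  apply: (loc_red_eq0 chF).
  rewrite rmorphB -!(coef_map (@loc_red _)) rmorphXn /= map_comp_poly map_polyXn.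
  by rewrite Fp_poly_expp // subrr.
have {}Ez : (U0 ^+ p)`_n - (U0 \Po 'X^p)`_n = p%:R * val z.
  move/(congr1 val): Ez.
  rewrite rmorphB rmorphM rmorph_nat -!(coef_map val) rmorphXn.
  by rewrite /= (map_comp_poly (\val : {rmorphism loc 'F_p -> rat})) map_polyXn.
have UE : \poly_(i < n.+1) AH_coef p i = U0 + AH_coef p n *: 'X^n.
  apply/polyP=> i; rewrite coefD coefZ coefXn U0E coef_poly ltnS leq_eqVlt.
  by case: eqP => [->|_]; rewrite ?ltnn ?mulr1 ?add0r ?mulr0 ?addr0.
have := @AH_dwork p n p_pr n (ltnSn n).
rewrite {1}UE (@eqX_expD_mulXn _ n) // ?U0E ?AH_coef0 // coefD coefZ coefXn eqxx mulr1.
set e := \poly_(i < n.+1) (_ / _).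
have e0 : e`_0 = 1 by rewrite coef_poly /= expr0 fact0 divr1.
rewrite coefM big_ord_recr /= subnn e0 mulr1.
have UX i : (i <= n)%N -> ((\poly_(i < n.+1) AH_coef p i) \Po 'X^p)`_i = (U0 \Po 'X^p)`_i.
  move=> i_n; rewrite !coef_comp_poly_Xn ?prime_gt0 //; case: ifP => // _.
  have lt : (i %/ p < n)%N.
    case: i i_n => [|i] i_n; first by rewrite div0n.
    by apply: leq_trans i_n; rewrite ltn_Pdiv.
  by rewrite U0E coef_poly lt ltnS ltnW.
rewrite UX // => E.
(* Each term of exp(pX) in positive degree has a factor p to spare. *)
have Sj (j : 'I_n) : e`_(n - j) = p%:R * (p%:R ^+ (n - j).-1 / (n - j)`!%:R).
  rewrite coef_poly ltnS leq_subr.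
  have : (0 < n - j)%N by rewrite subn_gt0.
  by case: (n - j)%N => // m _; rewrite exprS mulrA.
have -> : AH_coef p n = \sum_(j < n) (U0 \Po 'X^p)`_j * (p%:R ^+ (n - j).-1 / (n - j)`!%:R) - val z.
  apply: (mulfI p0); rewrite mulrBr -Ez mulr_sumr -[LHS](addKr (U0 ^+ p)`_n) E.
  under eq_bigr => j _ do rewrite UX ?(ltnW (ltn_ord j)) // Sj mulrCA.
  by ring.
rewrite rpredB ?(valP z) // rpred_sum // => j _; rewrite rpredM //; last first.
  have : (0 < n - j)%N by rewrite subn_gt0.
  by case: (n - j)%N => // m _ /=; apply: loc_exp_fact.
rewrite coef_comp_poly_Xn ?prime_gt0 // U0E.
by case: ifP => _; [case: ifP => [/IHn|_] | ]; rewrite // rpred0.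
Qed.

(** * The falling factorial modulo the square of p *)

Lemma Fp_two_neq0 p : prime p -> odd p -> 2%:R != 0 :> 'F_p.
Proof.
move=> p_pr p_odd; rewrite -(dvdn_pcharf (pchar_Fp p_pr)) dvdn_prime2 //.
by case: eqP p_odd => // ->.
Qed.

Definition ffpoly (R : comNzRingType) (n : nat) : {poly R} :=
  \prod_(s < n) ('X - s%:R%:P).

Section Ffpoly.
Variable R : comNzRingType.

Lemma ffpolyS n : ffpoly R n.+1 = ffpoly R n * ('X - n%:R%:P).
Proof. by rewrite /ffpoly big_ord_recr. Qed.

Lemma ffpoly_shift n :
  'X * (ffpoly R n \Po ('X - 1)) = ffpoly R n * ('X - n%:R%:P).
Proof.
rewrite -ffpolyS [RHS]big_ord_recl /= subr0; congr (_ * _).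
rewrite rmorph_prod /=; apply: eq_bigr => s _.
rewrite comp_polyB comp_polyX comp_polyC /bump /= add1n -natr1.
by rewrite polyCD polyC1; ring.
Qed.

(** Both sides are, up to sign, the product of the X + s for 0 <= s <= n. *)
Lemma ffpoly_opp n :
  ('X + n%:R%:P) * (ffpoly R n \Po (- 'X)) =
    (-1) ^+ n * ('X * (ffpoly R n \Po ('X + n%:R%:P))).
Proof.
pose Q := \prod_(s < n.+1) ('X + s%:R%:P) : {poly R}.
transitivity ((-1) ^+ n * Q).
  rewrite /Q big_ord_recr /= mulrA mulrC; congr (_ * _).
  rewrite -[n in (-1) ^+ n]card_ord -prodr_const -big_split rmorph_prod /=.
  apply: eq_bigr => s _; rewrite comp_polyB comp_polyX comp_polyC; ring.
congr (_ * _); rewrite /Q big_ord_recl /= addr0; congr (_ * _).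
rewrite rmorph_prod /= (reindex_inj rev_ord_inj) /=.
apply: eq_bigr => s _.
rewrite comp_polyB comp_polyX comp_polyC /bump /= add1n subnSK //.
by rewrite natrB 1?ltnW // polyCB; ring.
Qed.

Lemma comp_polyXD_taylor (f : {poly R}) (c : R) :
  exists h, f \Po ('X + c%:P) = f + c%:P * f^`() + c%:P ^+ 2 * h.
Proof.
elim/poly_ind: f => [|f a [h IH]].
  by exists 0; rewrite comp_poly0 deriv0 !mulr0 !addr0.
exists (f^`() + h * ('X + c%:P)).
rewrite comp_polyD comp_polyM comp_polyX comp_polyC IH.
by rewrite derivD derivM derivX derivC; ring.
Qed.
End Ffpoly.

Lemma ffpoly_map (R S : comNzRingType) (h : {rmorphism R -> S}) n :
  map_poly h (ffpoly R n) = ffpoly S n.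
Proof.
rewrite /ffpoly rmorph_prod; apply: eq_bigr => s _.
by rewrite rmorphB /= map_polyX map_polyC /= rmorph_nat.
Qed.

(** Both sides have the elements of 'F_p as simple roots. *)
Lemma ffpoly_Fp p : prime p -> ffpoly 'F_p p = 'X^p - 'X.
Proof.
move=> p_pr; have := finField_genPoly 'F_p; rewrite card_Fp // => ->.
pose h (s : 'I_p) : 'F_p := s%:R.
have h_bij : bijective h.
  apply: inj_card_bij; last by rewrite card_Fp // card_ord.
  move=> s t /(congr1 val); rewrite /= !val_Fp_nat // !modn_small //.
  exact: val_inj.
by rewrite (reindex h) //; apply: onW_bij.
Qed.

(** The quotient by p of the difference between X (X-1) ... (X-p+1) and
    X^p - X; its coefficients are signed Stirling numbers divided by p, up to
    a correction in degree 1. *)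
Definition ffrem (p : nat) : {poly int} :=
  \poly_(i < p) ((ffpoly int p - 'X^p + 'X)`_i %/ p)%Z.

Section Ffrem.
Variable p : nat.
Hypothesis p_pr : prime p.
Let p_gt0 : (0 < p)%N := prime_gt0 p_pr.
Let p1 : (1 < p)%N := prime_gt1 p_pr.

Lemma ffpolyE : ffpoly int p = 'X^p - 'X + p%:R * ffrem p.
Proof.
have -> : ffpoly int p = 'X^p - 'X + (ffpoly int p - 'X^p + 'X) by ring.
congr (_ + _); apply/polyP=> i; rewrite -polyC_natr coefCM coef_poly.
case: ltnP => ip.
  rewrite mulrC natz divzK // (dvdz_pcharf (pchar_Fp p_pr)).
  rewrite -coef_map rmorphD rmorphB /= ffpoly_map map_polyXn map_polyX.
  by rewrite ffpoly_Fp // (_ : _ - _ - _ + _ = 0) ?coef0 //; ring.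
rewrite mulr0 coefD coefB coefX coefXn.
have sz : size (ffpoly int p) = p.+1.
  by rewrite /ffpoly size_prod_XsubC /index_enum -enumT size_enum_ord.
move: ip; rewrite leq_eqVlt => /predU1P[<-|pi]; last first.
  rewrite nth_default ?sz // gtn_eqF // gtn_eqF ?subr0 ?addr0 //.
  exact: ltn_trans pi.
have /monicP : ffpoly int p \is monic by apply: monic_prod_XsubC.
by rewrite lead_coefE sz /= => ->; rewrite eqxx gtn_eqF // subrr addr0.
Qed.

Lemma coef_ffrem0 : (ffrem p)`_0 = 0.
Proof.
have := congr1 (fun f : {poly int} => f`_0) ffpolyE.
rewrite -[in LHS]horner_coef0 /ffpoly horner_prod; case: p p1 => // q q1.
rewrite big_ord_recl hornerXsubC subrr mul0r !coefD coefN coefX coefXn /=.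
rewrite oppr0 !add0r -polyC_natr coefCM => /esym/eqP.
by rewrite mulf_eq0 pnatr_eq0 => /eqP.
Qed.

Lemma size_ffrem : (size (ffrem p) <= p)%N.
Proof. exact: size_poly. Qed.

Definition ffremF : {poly 'F_p} := map_poly intr (ffrem p).

Lemma polyFp_natr : p%:R = 0 :> {poly 'F_p}.
Proof. by rewrite -polyC_natr pchar_Fp_0. Qed.

(** For odd p the reflection q(-X) is - (X (X+1) ... (X+p-1)), which
    ffpoly_opp relates to q(X+p), itself equal to q + p q' modulo p^2.
    The relation is the comparison of the terms of order p in ffpoly_opp, where
    q may be replaced by X^p - X and q' by -1; the term X^(p-1) comes from the
    factor X + p. *)
Lemma ffremF_opp : odd p -> ffremF + (ffremF \Po (- 'X)) = 'X^(p.-1).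
Proof.
move=> p_odd.
have [h Eh] := comp_polyXD_taylor (ffpoly int p) p%:R.
have := ffpoly_opp int p; rewrite {}Eh ffpolyE -signr_odd p_odd expr1.
rewrite comp_polyD comp_polyB comp_polyM comp_polyX comp_Xn_poly.
rewrite derivD derivB derivXn derivX derivM -polyC_natr derivC mul0r add0r.
rewrite exprNn -signr_odd p_odd expr1 comp_polyC polyC_natr.
set rm := ffrem p \Po - 'X; set r := ffrem p; rewrite -mulr_natl !mulr1.
rewrite -[p in 'X^p](prednK p_gt0) exprS.
set y := 'X^(p.-1); set P := p%:R => E.
(* The terms of order 0 in p agree; the first order ones give the left side. *)
have {}E : 'X * (r + rm - y) = P * - (rm + 'X * (y + r^`() + h)).
  have P0 : P != 0 by rewrite /P -polyC_natr polyC_eq0 pnatr_eq0 -lt0n.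
  apply: (mulfI P0); apply/eqP; rewrite -subr_eq0; move/eqP: E.
  by rewrite -subr_eq0 => /eqP E; apply/eqP; rewrite -[RHS]E; ring.
have := congr1 (map_poly (intr : int -> 'F_p)) E.
rewrite !rmorphM /= rmorph_nat polyFp_natr mul0r map_polyX => /eqP.
rewrite mulf_eq0 polyX_eq0 /= rmorphB rmorphD /= subr_eq0 => /eqP.
by rewrite map_comp_poly rmorphN /= map_polyX map_polyXn.
Qed.

End Ffrem.

(** * The differential equation of the p-section *)

Lemma expD1_2 (R : comNzRingType) (y : R) n :
  exists h, (1 + y) ^+ n = 1 + n%:R * y + y ^+ 2 * h.
Proof.
elim: n => [|n [h IHn]]; first by exists 0; rewrite expr0; ring.
exists (n%:R + (1 + y) * h); rewrite exprS IHn -natr1; ring.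
Qed.

(** The truncation modulo X^(p^2) of the sum of the X^(p^i), that is of theta
    applied to the Artin-Hasse logarithm. *)
Definition AH_dlog (R : comNzRingType) (p : nat) : {poly R} := 'X + 'X^p.

(** X^n (1 + X^(p-1))^n: for n >= 2 the next term of the binomial expansion has
    degree n + 2(p-1) >= 2p, and for n < 2 there is none. *)
Lemma eqX_AH_dlog_exp (R : comNzRingType) p n : (0 < p)%N ->
  eqX (2 * p) (AH_dlog R p ^+ n) ('X^n + n%:R *: 'X^(n + p.-1)).
Proof.
move=> p_gt0.
have LE : AH_dlog R p = 'X * (1 + 'X^(p.-1)).
  by rewrite mulrDr mulr1 -exprS prednK.
case: n => [|[|n]].
- by rewrite expr0 scale0r addr0.
- by rewrite !expr1 scale1r add1n prednK.
rewrite LE exprMn; have [h ->] := expD1_2 ('X^(p.-1) : {poly R}) n.+2.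
set m := n.+2.
apply: (@eqX_trans _ _ ('X^m + m%:R *: 'X^(m + p.-1) + 'X^(m + p.-1 + p.-1) * h)).
  by apply: eqX_eq; rewrite -mul_polyC polyC_natr !exprD; ring.
rewrite -[X in eqX _ _ X]addr0; apply: eqXD; first exact: eqX_refl.
by apply: eqXXn0; rewrite /m; lia.
Qed.

(** The argument applies to any solution u of the Artin-Hasse recurrence in a
    ring where p can be cancelled and which maps to 'F_p. *)
Section ODE.
Variables (O : comNzRingType) (p : nat) (phi : {rmorphism O -> 'F_p}) (u : nat -> O).
Hypotheses (p_pr : prime p) (p_odd : odd p).
Hypothesis p_reg : GRing.lreg (p%:R : O).
Hypothesis u_rec : forall n,
  n%:R * u n = \sum_(j < n.+1) (ppow p j)%:R * u (n - j).

Let p_gt0 : (0 < p)%N := prime_gt0 p_pr.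
Let p1 : (1 < p)%N := prime_gt1 p_pr.
Local Notation N := (2 * p)%N.

Lemma ppow_small j : (j < p ^ 3)%N ->
  (ppow p j)%:R = (j == 1%N)%:R + (j == p)%:R + (j == (p * p)%N)%:R :> O.
Proof.
move=> jp; have pp : (p < p * p)%N by rewrite ltn_Pmulr.
case: (ppowP j p1) => [[i ij]|nj].
  have : (i < 3)%N by rewrite -(ltn_exp2l _ _ p1) ij.
  case: i ij => [|[|[|//]]] <- _; rewrite ?expn0 ?expn1 -?mulnn eqxx.
  - by rewrite (ltn_eqF p1) ltn_eqF ?(ltn_trans p1) // !addr0.
  - by rewrite (gtn_eqF p1) (ltn_eqF pp) add0r addr0.
  - by rewrite gtn_eqF ?(ltn_trans p1) // (gtn_eqF pp) !add0r.
case: eqP nj => [->|_] nj; first by case: nj; exists 0%N.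
case: eqP nj => [->|_] nj; first by case: nj; exists 1%N.
case: eqP nj => [->|_] nj; first by case: nj; exists 2%N; rewrite mulnn.
by rewrite !addr0.
Qed.

Lemma u_rec_small n : (n < p ^ 3)%N ->
  n%:R * u n = (if (1 <= n)%N then u (n - 1) else 0)
     + (if (p <= n)%N then u (n - p) else 0)
     + (if (p * p <= n)%N then u (n - p * p) else 0).
Proof.
move=> np; rewrite u_rec.
have pick a : \sum_(j < n.+1) ((j : nat) == a)%:R * u (n - j)
    = if (a <= n)%N then u (n - a) else 0.
  case: leqP => an; last first.
    rewrite big1 // => j _; rewrite ltn_eqF ?mul0r //.
    by apply: leq_ltn_trans an; rewrite -ltnS.
  have an' : (a < n.+1)%N by [].
  rewrite (bigD1 (Ordinal an')) //= eqxx mul1r big1 ?addr0 // => j ja.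
  by rewrite -val_eqE /= in ja; rewrite (negPf ja) mul0r.
rewrite -!pick -!big_split /=; apply: eq_bigr => j _.
have jn : (j <= n)%N by rewrite -ltnS.
by rewrite ppow_small ?(leq_ltn_trans jn np) // !mulrDl.
Qed.

(** The coefficient u_(rp-s), understood as 0 when rp < s.  Counting residues
    downwards from rp makes the operators p theta - L - s map one section to
    the next one, the last one being X times the first. *)
Definition psect_coef (s r : nat) : O := if (s <= r * p)%N then u (r * p - s) else 0.
Definition psect (s : nat) : {poly O} := \poly_(r < N) psect_coef s r.
Local Notation A := (psect 0).
Local Notation L := (AH_dlog O p).

(** This is the recurrence at n = rp - s: its terms u_(n-1), u_(n-p) and
    u_(n-p^2) belong to the sections s+1, s, s, at r, r-1, r-p.  The bound
    r < 2p keeps n below p^3, so that no further term occurs. *)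
Lemma psect_coef_rec s r : (s < p)%N -> (r < N)%N ->
  psect_coef s.+1 r = p%:R * r%:R * psect_coef s r - s%:R * psect_coef s r
     - (if (0 < r)%N then psect_coef s (r - 1) else 0)
     - (if (p <= r)%N then psect_coef s (r - p) else 0).
Proof.
move=> sp rN; have p3 : (3 <= p)%N by case: p p1 p_odd => [|[|[|]]].
rewrite /psect_coef; case: (leqP s (r * p)) => srp; last first.
  have r0 : r = 0%N by case: r srp {rN} => // r; rewrite mulSn; lia.
  rewrite {}r0 mul0n in srp *.
  have p0 : (p <= 0)%N = false by rewrite leqn0 gtn_eqF.
  by rewrite ltn0 p0 ltnn !mulr0 !subr0.
have n3 : (r * p - s < p ^ 3)%N.
  apply: leq_ltn_trans (leq_subr _ _) _; rewrite expnSr ltn_mul2r p_gt0 -mulnn.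
  by apply: (leq_trans rN); rewrite leq_mul2r ltnW ?orbT.
have := u_rec_small n3; rewrite natrB // natrM => E.
rewrite -mulrBl [p%:R * _]mulrC E.
have -> : (if (p <= r * p - s)%N then u (r * p - s - p) else 0)
  = (if (0 < r)%N then if (s <= (r - 1) * p)%N then u ((r - 1) * p - s) else 0 else 0).
  case: r {rN n3 E} srp => [|r] srp.
    by rewrite mul0n sub0n leqn0 gtn_eqF.
  rewrite subn1 /= mulSn in srp *; move: (r * p)%N srp => x srp.
  have -> : (p <= p + x - s)%N = (s <= x)%N by lia.
  by case: ifP => // sx; congr u; lia.
have -> : (if (p * p <= r * p - s)%N then u (r * p - s - p * p) else 0)
  = (if (p <= r)%N then if (s <= (r - p) * p)%N then u ((r - p) * p - s) else 0 else 0).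
  case: (leqP p r) => pr; last first.
    have lt : (r * p < p * p)%N by rewrite ltn_pmul2r.
    by case: leqP => // h; lia.
  rewrite -{1 2}(subnK pr) mulnDl.
  have := srp; rewrite -{1}(subnK pr) mulnDl.
  move: ((r - p) * p)%N (p * p)%N => x y srp'.
  have -> : (y <= x + y - s)%N = (s <= x)%N by lia.
  by case: ifP => // sx; congr u; lia.
have -> : (1 <= r * p - s)%N = (s.+1 <= r * p)%N by lia.
have -> : (r * p - s - 1 = r * p - s.+1)%N by lia.
by ring.
Qed.

Lemma psect_rec s : (s < p)%N ->
  eqX N (psect s.+1) (p%:R * theta (psect s) + (- L - s%:R) * psect s).
Proof.
move=> sp r rN; rewrite coef_poly rN psect_coef_rec //.
rewrite mulrBl mulNr /AH_dlog mulrDl !coefD !coefN -!polyC_natr !coefCM coef_theta.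
rewrite coefD coefXM coefXnM coef_poly rN.
have cS j : (j <= r)%N -> (psect s)`_j = psect_coef s j.
  by move=> jr; rewrite coef_poly (leq_ltn_trans jr rN).
rewrite !cS ?leq_subr ?leq_pred // subn1.
by rewrite lt0n; case: (eqVneq r 0%N); case: (ltnP r p) => _ _ /=; ring.
Qed.

Lemma theta_pow2 (h : {poly O}) : theta (p%:R ^+ 2 * h) = p%:R ^+ 2 * theta h.
Proof. by rewrite expr2 -!mulrA !theta_natM. Qed.

Local Notation q := (ffpoly O).

(** First order expansion in p of the product of the operators
    p theta - L - i, i < s, applied to the section 0.  One more factor
    multiplies q_s by X - s, so q_s' and q_s'' change by the product rule,
    and these are the terms that p theta creates.  The factor 2 avoids the
    divided second derivative. *)
Lemma psect_expand s : (s <= p)%N -> exists h,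
  eqX N (2%:R * psect s)
    (2%:R * ((q s \Po - L) * A) + 2%:R * (p%:R * (((q s)^`() \Po - L) * theta A))
     + p%:R * (((q s)^`()^`() \Po - L) * theta (- L) * A) + p%:R ^+ 2 * h).
Proof.
elim: s => [|s IHs] sp.
  exists 0; rewrite /ffpoly big_ord0 -polyC1 derivC deriv0 !comp_polyC.
  by apply: eqX_eq; rewrite polyC1; ring.
have [h E] := IHs (ltnW sp).
set y := - L in E *; set a0 := q s \Po y in E *.
set a1 := (q s)^`() \Po y in E *; set a2 := _ \Po y in E *.
exists (2%:R * (a2 * theta y * theta A) + 2%:R * (a1 * theta (theta A))
   + theta (a2 * theta y * A) + p%:R * theta h + (y - s%:R) * h).
apply: (@eqX_trans _ _ (p%:R * theta (2%:R * psect s) + (y - s%:R) * (2%:R * psect s))).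
  apply: eqX_trans (eqXM (@eqX_refl _ _ _) (psect_rec sp)) _.
  by apply: eqX_eq; rewrite -/y theta_natM; ring.
apply: eqX_trans (eqXD (eqXM (@eqX_refl _ _ _) (eqX_theta E))
                       (eqXM (@eqX_refl _ _ _) E)) _.
apply: eqX_eq; rewrite ffpolyS !derivM !derivXsubC !mulr1 derivD derivM derivXsubC mulr1.
rewrite !comp_polyD !comp_polyM comp_polyB comp_polyX comp_polyC polyC_natr.
rewrite -!/y -!/a0 -!/a1 -!/a2 3!thetaD theta_pow2 !theta_natM.
rewrite (thetaM a0) (thetaM a1) /a0 /a1 !theta_comp -!/a1 -!/a2 /=.
by ring.
Qed.

Lemma psect_p : eqX N (psect p) ('X * A).
Proof.
move=> r rN; rewrite coefXM !coef_poly rN /psect_coef (leq_ltn_trans (leq_pred r) rN).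
case: r rN => [|r] rN /=; first by rewrite mul0n leqn0 gtn_eqF.
by rewrite mulSn leq_addr addKn subn0.
Qed.

(** The expansion at s = p, compared with psect_p.  The term X A cancels against
    q(-L) = X - p X^(2p-1) + p rho(-L), and every term left has a factor p. *)
Lemma psect_ode_natM : exists h,
  eqX N (p%:R * (2%:R * theta A)) (p%:R *
     (2%:R * (((map_poly intr (ffrem p) \Po - L) - 'X^(N.-1)) * A) + p%:R * h)).
Proof.
have [h E] := psect_expand (leqnn p).
have {}E := eqX_trans (eqX_sym (eqXM (@eqX_refl _ N (2%:R)) psect_p)) E.
set r : {poly O} := map_poly intr (ffrem p).
have qE : ffpoly O p = 'X^p - 'X + p%:R * r.
  rewrite -(ffpoly_map (intr : {rmorphism int -> O})) ffpolyE // /r.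
  by rewrite rmorphD rmorphB rmorphM /= rmorph_nat map_polyX map_polyXn.
(* k is X^(p-1): naming it hides the only coefficient p that is not p%:R * _. *)
have [k kE] : exists k : {poly O}, 'X^(p.-1) *+ p = p%:R * k :> {poly O}.
  by exists 'X^(p.-1); rewrite mulr_natl.
have q1E : (ffpoly O p)^`() = p%:R * (k + r^`()) - 1.
  rewrite qE derivD derivB derivXn derivX derivM kE -polyC_natr derivC; ring.
have q2E : (ffpoly O p)^`()^`() = p%:R * (k^`() + r^`()^`()).
  by rewrite q1E -polyC_natr derivB derivM derivC -polyC1 derivC derivD; ring.
exists (2%:R * ((k + r^`()) \Po - L) * theta A
   + ((k^`() + r^`()^`()) \Po - L) * theta (- L) * A + h).
have LpE : eqX N (- L ^+ p + L) ('X - p%:R * 'X^(N.-1)).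
  apply: eqX_trans (eqXD (eqXN (eqX_AH_dlog_exp O p p_gt0)) (@eqX_refl _ _ _)) _.
  apply: eqX_eq; rewrite /AH_dlog -mul_polyC polyC_natr.
  have -> : (p + p.-1 = N.-1)%N by lia.
  by ring.
have {}E : eqX N (p%:R * (2%:R * theta A)) (p%:R * (2%:R * theta A)
    + (2%:R * ((ffpoly O p \Po - L) * A) + 2%:R * (p%:R * (((ffpoly O p)^`() \Po - L) * theta A))
     + p%:R * (((ffpoly O p)^`()^`() \Po - L) * theta (- L) * A) + p%:R ^+ 2 * h)
    - 2%:R * ('X * A)).
  rewrite -[X in eqX _ X _]addr0 -addrA; apply: eqXD; first exact: eqX_refl.
  rewrite -(subrr (2%:R * ('X * A))); apply: eqXD E _; exact: eqX_refl.
apply: eqX_trans E _.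
rewrite q2E q1E qE !(comp_polyB, comp_polyD, comp_polyM) comp_polyX comp_Xn_poly.
have -> : (p%:R \Po - L) = p%:R by rewrite -polyC_natr comp_polyC polyC_natr.
have -> : (1 \Po - L) = 1 by rewrite -polyC1 comp_polyC.
rewrite exprNn -signr_odd p_odd expr1.
set rL := r \Po _; set r1 := r^`() \Po _; set k0 := k \Po _.
set k1 := k^`() \Po _; set r2 := _ \Po _.
apply: (@eqX_trans _ _ (2%:R * ((- L ^+ p + L) * A) +
   (p%:R * (2%:R * (rL * A)) + p%:R ^+ 2 * (2%:R * (k0 + r1) * theta A
     + (k1 + r2) * theta (- L) * A + h) - 2%:R * ('X * A)))).
  by apply: eqX_eq; ring.
apply: eqX_trans (eqXD (eqXM (@eqX_refl _ _ _) (eqXM LpE (@eqX_refl _ _ _))) (@eqX_refl _ _ _)) _.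
by apply: eqX_eq; ring.
Qed.

Lemma psect_ode :
  let a := map_poly phi A in
  eqX N (theta a) (((ffremF p \Po - AH_dlog _ p) - 'X^(N.-1)) * a).
Proof.
move=> a; have [h E] := psect_ode_natM.
have {}E : eqX N (2%:R * theta A) (2%:R * (((map_poly intr (ffrem p) \Po - L) - 'X^(N.-1)) * A) + p%:R * h).
  by move=> i iN; have := E i iN; rewrite -polyC_natr !coefCM => /p_reg.
have := eqX_map phi E.
have phiM (f g : {poly O}) : map_poly phi (f * g) = map_poly phi f * map_poly phi g.
  exact: rmorphM.
have phi_n n : map_poly phi (n%:R : {poly O}) = n%:R by rewrite rmorph_nat.
rewrite rmorphD /= (phiM _ (theta A)) theta_map !phiM !phi_n rmorphB /= map_comp_poly -/a.
rewrite -map_poly_comp_id0 ?rmorph0 //.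
have p0g (g : {poly 'F_p}) : p%:R * g = 0 by rewrite (polyFp_natr p_pr) mul0r.
rewrite p0g addr0 map_polyXn rmorphN /AH_dlog rmorphD /= map_polyX map_polyXn.
rewrite (eq_map_poly (_ : _ =1 intr)) => [{}E i iN|z]; last by rewrite /= rmorph_int.
have := E i iN; rewrite -polyC_natr !coefCM; apply: mulfI; exact: Fp_two_neq0.
Qed.
End ODE.

(** * Consequences modulo p *)

Lemma coef_comp_polyNX (R : comNzRingType) (f : {poly R}) i :
  (f \Po - 'X)`_i = (-1) ^+ i * f`_i.
Proof.
elim/poly_ind: f i => [|f c IHf] i; first by rewrite comp_poly0 coef0 mulr0.
rewrite comp_polyD comp_polyM comp_polyX comp_polyC mulrN !coefD coefN !coefMX !coefC.
case: i => [|i] /=; first by rewrite oppr0 expr0 mul1r.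
by rewrite IHf !addr0 exprS; ring.
Qed.

(** From here on, a(X) is the reduced p-section and b = a(X) a(-X). *)
Section FpODE.
Variables (p : nat) (a : {poly 'F_p}).
Hypotheses (p_pr : prime p) (p_odd : odd p).
Let p_gt0 : (0 < p)%N := prime_gt0 p_pr.
Let p1 : (1 < p)%N := prime_gt1 p_pr.
Local Notation N := (2 * p)%N.
Local Notation L := (AH_dlog 'F_p p).
Local Notation r := (ffremF p).
Hypothesis a0 : a`_0 = 1.
Hypothesis a_ode : eqX N (theta a) (((r \Po - L) - 'X^(N.-1)) * a).

Let am := a \Po - 'X.
Let b := a * am.

Lemma odd_prime_ge3 : (3 <= p)%N.
Proof. by case: p p1 p_odd => [|[|[|]]]. Qed.

Lemma theta_reflect : theta am = theta a \Po - 'X.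
Proof.
rewrite /am theta_comp /theta comp_polyM comp_polyX derivN derivX; ring.
Qed.

Lemma AH_dlog_opp : L \Po - 'X = - L.
Proof.
rewrite /AH_dlog comp_polyD comp_polyX comp_Xn_poly exprNn -signr_odd p_odd; ring.
Qed.

Lemma reflect_ode : eqX N (theta am) (((r \Po L) + 'X^(N.-1)) * am).
Proof.
rewrite theta_reflect; apply: (@eqX_trans _ _ ((((r \Po - L) - 'X^(N.-1)) * a) \Po - 'X)).
  by apply: eqX_comp => //; rewrite coefN coefX oppr0.
apply: eqX_eq; rewrite comp_polyM comp_polyB comp_Xn_poly -comp_polyA.
rewrite (rmorphN (comp_poly _)) /= AH_dlog_opp opprK exprNn -signr_odd.
have -> : odd N.-1 by rewrite -subn1 oddB ?muln_gt0 //= oddM.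
by rewrite expr1 mulN1r opprK.
Qed.

(** Adding the equations of a(X) and a(-X), the terms X^(2p-1) cancel and
    ffremF_opp applies at L. *)
Lemma refl_prod_ode : eqX N (theta b) (L ^+ p.-1 * b).
Proof.
rewrite thetaM.
apply: eqX_trans (eqXD (eqXM a_ode (@eqX_refl _ _ am)) (eqXM (@eqX_refl _ _ a) reflect_ode)) _.
have <- : (r \Po - L) + (r \Po L) = L ^+ p.-1.
  rewrite -[RHS]comp_Xn_poly -ffremF_opp // comp_polyD -comp_polyA.
  by rewrite (rmorphN (comp_poly _)) /= comp_polyX addrC.
by apply: eqX_eq; rewrite /b; ring.
Qed.

Lemma coef_refl_prod_odd i : odd i -> b`_i = 0.
Proof.
move=> i_odd; have bm : b \Po - 'X = b.
  rewrite /b /am comp_polyM -comp_polyA (rmorphN (comp_poly _)) /= comp_polyX opprK.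
  by rewrite comp_polyXr mulrC.
have := coef_comp_polyNX b i; rewrite bm -signr_odd i_odd expr1 mulN1r => /eqP.
rewrite -addr_eq0 -mulr2n -mulr_natl mulf_eq0 (negPf (Fp_two_neq0 p_pr p_odd)).
by move/eqP.
Qed.

Lemma Fp_natr_pred : p.-1%:R = -1 :> 'F_p.
Proof.
by apply/eqP; rewrite -addr_eq0 natr1 prednK // -(dvdn_pcharf (pchar_Fp p_pr)).
Qed.

Lemma eqX_AH_dlog_pred : eqX N (L ^+ p.-1) ('X^(p.-1) - 'X^(p.-1 + p.-1)).
Proof.
apply: eqX_trans (eqX_AH_dlog_exp _ _ p_gt0) _.
by apply: eqX_eq; rewrite Fp_natr_pred scaleN1r.
Qed.

(** The right-hand side is 1 - L^(p-1) modulo X^(2p); it satisfies the same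
    equation as b because theta L = X = L - L^p up to truncation.  The
    equation leaves the coefficients of degree divisible by p free: in degree 0
    both are 1, in degree p both are 0, that of b by parity. *)
Lemma refl_prodE : eqX N b (1 - 'X^(p.-1) + 'X^(p.-1 + p.-1)).
Proof.
set c := _ + _; have p3 := odd_prime_ge3.
have c_ode : eqX N (theta c) (L ^+ p.-1 * c).
  apply: eqX_trans (eqX_sym (eqXM eqX_AH_dlog_pred (@eqX_refl _ _ _))).
  have -> : theta c = 'X^(p.-1) - 2%:R * 'X^(p.-1 + p.-1).
    apply/polyP=> i; rewrite coef_theta -polyC_natr !coefD !coefN coefCM coef1 !coefXn.
    case: (eqVneq i 0%N) => [->|i0].
      have -> : (0 == p.-1)%N = false by lia.
      have -> : (0 == p.-1 + p.-1)%N = false by lia.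
      by rewrite /= mul0r; ring.
    case: eqP => [->|_].
      have -> : (p.-1 == p.-1 + p.-1)%N = false by lia.
      by rewrite Fp_natr_pred /=; ring.
    case: eqP => [->|_] /=; last by ring.
    by rewrite natrD Fp_natr_pred; ring.
  apply: (@eqX_trans _ _ ('X^(p.-1) - 2%:R * 'X^(p.-1 + p.-1) +
      'X^(p.-1 + p.-1 + p.-1) * (2%:R - 'X^(p.-1)))).
    apply: eqX_sym; rewrite -[X in eqX _ _ X]addr0; apply: eqXD => //.
    by apply: eqXXn0; lia.
  by apply: eqX_eq; rewrite /c !exprD; ring.
have d_ode : eqX N (theta (b - c)) (L ^+ p.-1 * (b - c)).
  rewrite mulrBr; apply: eqX_trans (eqXD refl_prod_ode (eqXN c_ode)).
  by apply: eqX_eq; rewrite /theta derivB; ring.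
have c0 : c`_0 = 1.
  rewrite !coefD coefN coef1 !coefXn.
  have -> : (0 == p.-1)%N = false by lia.
  have -> : (0 == p.-1 + p.-1)%N = false by lia.
  by rewrite subr0 addr0.
have cp : c`_p = 0.
  rewrite !coefD coefN coef1 !coefXn.
  have -> : (p == p.-1)%N = false by lia.
  have -> : (p == p.-1 + p.-1)%N = false by lia.
  by rewrite (gtn_eqF p_gt0) subr0 addr0.
have b0 : b`_0 = 1.
  by rewrite /b coefM big_ord1 a0 /am coef_comp_polyNX a0 !mulr1.
(* Uniqueness is tested on the difference, which satisfies the same equation. *)
suff d0 i : (i < N)%N -> (b - c)`_i = 0.
  by move=> i iN; apply/eqP; rewrite -subr_eq0 -coefB d0.
elim/ltn_ind: i => i IHi iN.
case: (boolP (p %| i)%N) => [/dvdnP[k ik]|pi].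
  have : (k < 2)%N by rewrite -(ltn_pmul2r p_gt0) -ik.
  case: k ik => [|[|//]] -> _; first by rewrite mul0n coefB b0 c0 subrr.
  by rewrite mul1n coefB cp coef_refl_prod_odd // subrr.
apply: (@mulfI _ i%:R); first by rewrite -(dvdn_pcharf (pchar_Fp p_pr)).
rewrite -coef_theta d_ode // mulr0 coefM big1 // => -[[|j] ji] _ /=.
  rewrite eqX_AH_dlog_pred ?muln_gt0 // coefB !coefXn.
  have -> : (0 == p.-1)%N = false by lia.
  have -> : (0 == p.-1 + p.-1)%N = false by lia.
  by rewrite subrr mul0r.
by rewrite IHi ?mulr0 //; lia.
Qed.

(** Term by term from eqX_AH_dlog_exp, which sends X^n to
    X^n + n X^(n+p-1). *)
Lemma ffrem_comp_AH_dlog : eqX N (r \Po L) (r + 'X^(p.-1) * theta r).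
Proof.
rewrite comp_polyE.
have -> : r + 'X^(p.-1) * theta r =
    \sum_(i < size r) r`_i *: ('X^i + i%:R *: 'X^(i + p.-1)).
  have -> : theta r = \poly_(i < size r) (i%:R * r`_i).
    apply/polyP=> i; rewrite coef_theta [RHS]coef_poly; case: ltnP => // sz.
    by rewrite nth_default // mulr0.
  rewrite -{1}[r]coefK !poly_def mulr_sumr -big_split /=; apply: eq_bigr => i _.
  by rewrite scalerDr scalerA exprD -scalerAr (mulrC 'X^(p.-1)) (mulrC i%:R).
apply: eqX_sum => i j jN; rewrite !coefZ; congr (_ * _).
exact: eqX_AH_dlog_exp.
Qed.

(** By reflect_ode and refl_prodE this is the product of
    rho + X^(p-1) theta rho + X^(2p-1) and 1 - X^(p-1) + X^(2p-2).  Only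
    rho + X^(p-1) (theta rho - rho) + X^(2p-1) survives modulo X^(2p): the
    candidate X^(2p-2) (rho - theta rho) is divisible by X^(2p), since
    rho - theta rho has no term of degree less than 2.  As rho has degree less
    than p, its own coefficient of degree k vanishes. *)
Lemma coef_thetaM_reflect k : (p <= k < N)%N ->
  (theta am * a)`_k = (k - p)%:R * r`_(k - p + 1) + (k == N.-1)%:R.
Proof.
move=> /andP[pk kN]; have p3 := odd_prime_ge3.
have E : eqX N (theta am * a)
    (r + 'X^(p.-1) * (theta r - r) + 'X^(N.-1)).
  apply: eqX_trans (eqXM reflect_ode (@eqX_refl _ _ _)) _.
  apply: (@eqX_trans _ _ ((r + 'X^(p.-1) * theta r + 'X^(N.-1)) *
     (1 - 'X^(p.-1) + 'X^(p.-1 + p.-1)))).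
    apply: eqX_trans (eqXM (eqXD ffrem_comp_AH_dlog (@eqX_refl _ _ _)) refl_prodE).
    by apply: eqX_eq; rewrite /b; ring.
  have [s rE] : exists s, r = 'X * s.
    have : root r 0 by rewrite /root horner_coef0 coef_map /= coef_ffrem0.
    by case/factor_theorem => s ->; exists s; rewrite subr0 mulrC.
  have trE : theta r = 'X * (s + theta s).
    by rewrite rE thetaM /theta derivX; ring.
  (* All exponents are expressed through X and z, so that ring can compare them. *)
  pose z : {poly 'F_p} := 'X^(p - 2).
  have xE : 'X^(p.-1) = 'X * z :> {poly 'F_p}.
    by rewrite -exprS; congr ('X^_); lia.
  have NE : 'X^N = 'X ^+ 2 * ('X * z) ^+ 2 :> {poly 'F_p}.
    by rewrite -xE -exprM -exprD; congr ('X^_); lia.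
  have N1E : 'X^(N.-1) = 'X * ('X * z) ^+ 2 :> {poly 'F_p}.
    by rewrite -xE -exprM -exprS; congr ('X^_); lia.
  apply: (@eqX_trans _ _ (r + 'X^(p.-1) * (theta r - r) + 'X^(N.-1)
     + 'X^N * (z * (s + theta s) - s^`() - z + z * 'X^(p.-1)))).
    by apply: eqX_eq; rewrite trE rE NE N1E exprD !xE /theta; ring.
  rewrite -[X in eqX _ _ X]addr0; apply: eqXD => //.
  exact: eqXXn0.
rewrite E // !coefD coefXnM coefXn coefB coef_theta.
rewrite nth_default ?add0r; last first.
  by rewrite (leq_trans (size_poly _ _)) // (leq_trans (size_ffrem p)).
have -> : (k < p.-1)%N = false by lia.
have -> : (k - p.-1 = k - p + 1)%N by lia.
by rewrite natrD; ring.
Qed.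
End FpODE.

(** * Bernoulli numbers modulo p *)

Lemma coef_Xsub1_exp (R : comNzRingType) n j : (j <= n)%N ->
  (('X - 1) ^+ n : {poly R})`_j = (-1) ^+ (n - j) * 'C(n, j)%:R.
Proof.
move=> jn; rewrite exprDn coef_sum.
have lt : (n - j < n.+1)%N by rewrite ltnS leq_subr.
rewrite (bigD1 (Ordinal lt)) //= big1 ?addr0 => [|i].
  rewrite subKn // bin_sub // coefMn -polyCN -polyC_exp coefMC coefXn eqxx.
  by rewrite mul1r mulr_natr.
rewrite -val_eqE /= => ij; rewrite coefMn -polyCN -polyC_exp coefMC coefXn.
have -> : (j == n - i)%N = false.
  by apply: contraNF ij => /eqP ->; rewrite subKn // -ltnS.
by rewrite mul0r mul0rn.
Qed.

Section FpBernoulli.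
Variable p : nat.
Hypotheses (p_pr : prime p).
Let p_gt0 : (0 < p)%N := prime_gt0 p_pr.
Let p1 : (1 < p)%N := prime_gt1 p_pr.
Local Notation r := (ffremF p).

Lemma Fp_natr_neq0 n : (0 < n < p)%N -> n%:R != 0 :> 'F_p.
Proof.
by case/andP=> n0 np; rewrite -(dvdn_pcharf (pchar_Fp p_pr)) gtnNdvd.
Qed.

Lemma Fp_natrB n : (n <= p)%N -> (p - n)%:R = - n%:R :> 'F_p.
Proof. by move=> np; rewrite natrB // pchar_Fp_0 // sub0r. Qed.

(** p - 1 - i = - (i+1) modulo p: this is the usual expression of a binomial
    coefficient with a negative upper entry. *)
Lemma Fp_bin_neg i k : (i + k < p)%N ->
  (-1) ^+ k * 'C(p - 1 - i, k)%:R = 'C(i + k, k)%:R :> 'F_p.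
Proof.
elim: k => [|k IHk] ikp; first by rewrite !bin0 mul1r.
apply: (@mulfI _ k.+1%:R); first by apply: Fp_natr_neq0; lia.
rewrite mulrCA -!natrM mul_bin_left addnS -mul_bin_diag !natrM -IHk; last by lia.
have -> : (p - 1 - i - k = p - (i + k).+1)%N by lia.
by rewrite Fp_natrB //; [rewrite exprS; ring | lia].
Qed.

(** Modulo p, and up to its constant term, this is the Bernoulli polynomial
    B_(p-1)(X+1); see bern_poly_diff. *)
Definition bern_poly : {poly 'F_p} := r^`() + 'X^(p.-1).

(** Differentiate X (q(X) - q(X-1)) = p q(X): since q' is a constant plus a
    multiple of p, both sides can be divided by p before reduction. *)
Lemma bern_poly_diff : bern_poly - (bern_poly \Po ('X - 1)) = - 'X^(p.-2).
Proof.
pose q := ffpoly int p; pose D := q - (q \Po ('X - 1)).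
have XD : 'X * D = p%:R * q.
  by rewrite /D mulrBr ffpoly_shift polyC_natr /q; ring.
have dq : q^`() = p%:R * ('X^(p.-1) + (ffrem p)^`()) - 1.
  rewrite /q ffpolyE // derivD derivB derivXn derivX derivM -polyC_natr derivC.
  by rewrite -mulr_natl polyC_natr; ring.
pose G : {poly int} := 'X^(p.-1) + (ffrem p)^`().
have dD : D^`() = p%:R * (G - (G \Po ('X - 1))).
  rewrite /D derivB deriv_comp -polyC1 derivXsubC mulr1 dq -/G polyC1.
  rewrite comp_polyB comp_polyM -polyC1 comp_polyC -!polyC_natr comp_polyC; ring.
have E : 'X ^+ 2 * (G - (G \Po ('X - 1))) = 'X * q^`() - q.
  have P0 : (p%:R : {poly int}) != 0 by rewrite -polyC_natr polyC_eq0 pnatr_eq0 -lt0n.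
  apply: (mulfI P0); rewrite mulrCA -dD mulrBr -XD.
  have := congr1 (fun f => 'X * f^`()) XD; rewrite /= derivM derivX derivM.
  rewrite -{1}polyC_natr derivC => E.
  have -> : p%:R * ('X * q^`()) = 'X * (0 * q + p%:R * q^`()) by ring.
  by rewrite -E; ring.
have := congr1 (map_poly (intr : int -> 'F_p)) E.
rewrite !(rmorphB, rmorphM, rmorphXn) /= map_polyX map_comp_poly.
rewrite !(rmorphB, rmorphD) /= rmorph1 map_polyXn map_polyX -!deriv_map /= -/r.
rewrite ffpoly_map ffpoly_Fp // derivB derivXn derivX.
rewrite -mulr_natl polyFp_natr // mul0r => {}E.
have X0 : ('X ^+ 2 : {poly 'F_p}) != 0 by rewrite expf_neq0 // polyX_eq0.
apply: (mulfI X0); rewrite /bern_poly [_ \Po _ + _]addrC [r^`() + _]addrC expr2 E.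
have -> : 'X^p = 'X * 'X * 'X^(p.-2) :> {poly 'F_p}.
  by rewrite -mulrA -!exprS; congr ('X^_); lia.
by ring.
Qed.

(** In B_(p-1)(X+1) the coefficient of X^(p-1-i) is (-1)^i 'C(p-1, i) B_i, and
    'C(p-1, i) = (-1)^i modulo p. *)
Definition bern_mod i : 'F_p := bern_poly`_(p - 1 - i).

Lemma bern_modS i : (0 < i < p)%N -> bern_mod i = (p - i)%:R * r`_(p - i).
Proof.
move=> ip; rewrite /bern_mod coefD coefXn coef_deriv mulr_natl.
have -> : (p - 1 - i == p.-1)%N = false by lia.
by rewrite addr0; congr (_`_ _ *+ _); lia.
Qed.

(** The coefficient of X^(p-2-M) in bern_poly_diff.  Its binomials
    'C(p-1-i, M+1-i) become 'C(M+1, i) by Fp_bin_neg; the index i = M+1 of the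
    shifted polynomial cancels with the unshifted one. *)
Lemma bern_mod_sum M : (M.+1 < p)%N ->
  \sum_(i < M.+1) 'C(M.+1, i)%:R * bern_mod i = (M == 0)%:R.
Proof.
move=> Mp; set j := (p - 1 - M.+1)%N.
have sG : (size bern_poly <= p)%N.
  apply: leq_trans (size_polyD _ _) _; rewrite geq_max size_polyXn prednK // leqnn andbT.
  apply: leq_trans (size_poly _ _) _; apply: leq_trans (leq_pred _) _.
  by apply: leq_trans (size_poly _ _) _; apply: size_ffrem.
have := congr1 (fun f : {poly 'F_p} => f`_j) bern_poly_diff.
rewrite /= coefB coefN coefXn.
have -> : (bern_poly \Po ('X - 1))`_j = \sum_(i < M.+2) 'C(M.+1, i)%:R * bern_mod i.
  rewrite comp_polyE coef_sum.
  rewrite (big_ord_widen p (fun n => (bern_poly`_n *: ('X - 1) ^+ n)`_j) sG) big_mkcond /=.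
  rewrite (reindex_inj rev_ord_inj) /=.
  rewrite [RHS](big_ord_widen p (fun i => 'C(M.+1, i)%:R * bern_mod i)) // [RHS]big_mkcond /=.
  apply: eq_bigr => i _; have ip := ltn_ord i.
  case: ltnP => [lt_sz|sz]; last first.
    case: ifP => // iM; rewrite /bern_mod nth_default ?mulr0 //.
    by apply: leq_trans sz _; lia.
  rewrite coefZ /bern_mod; have -> : (p - i.+1 = p - 1 - i)%N by lia.
  case: ltnP => iM; last first.
    rewrite [X in _ * X]nth_default ?mulr0 // -polyC1 size_exp_XsubC.
    by rewrite -subSn; lia.
  rewrite coef_Xsub1_exp; last by lia.
  have -> : (p - 1 - i - j = M.+1 - i)%N by lia.
  rewrite -bin_sub; last by lia.
  have -> : (p - 1 - i - j = M.+1 - i)%N by lia.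
  by rewrite Fp_bin_neg ?subnKC 1?mulrC // ?bin_sub //; lia.
rewrite big_ord_recr /= binn mul1r -/(bern_mod M.+1) => E.
have -> : (M == 0)%:R = ((j == p.-2)%:R : 'F_p) by congr (_ _)%:R; lia.
by rewrite -[RHS]opprK -E; ring.
Qed.

(** The recursion for B_i only divides by i+1, a unit modulo p. *)
Lemma bernoulli_loc i : (i.+1 < p)%N -> bernoulli i \in loc_pred 'F_p.
Proof.
elim/ltn_ind: i => i IHi ip.
have i0 : (i.+1%:R : rat) != 0 by rewrite pnatr_eq0.
have -> : bernoulli i = ((i == 0)%:R - \sum_(j < i) 'C(i.+1, j)%:R * bernoulli j) * i.+1%:R^-1.
  have := bernoulli_sum i; rewrite big_ord_recr /= binSn => <-.
  by rewrite addrAC subrr add0r mulrAC mulfV // mul1r.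
rewrite rpredM //; last by apply: loc_natV; apply: Fp_natr_neq0; lia.
rewrite rpredB ?rpred_nat // rpred_sum // => j _.
rewrite rpredM ?rpred_nat // IHi //; have := ltn_ord j; lia.
Qed.

Lemma bernoulli_mod_sum M : (M.+1 < p)%N ->
  \sum_(i < M.+1) 'C(M.+1, i)%:R * reduce_mod p (bernoulli i) = (M == 0)%:R.
Proof.
move=> Mp.
have locE i : (i < M.+1)%N -> val (to_loc 'F_p (bernoulli i)) = bernoulli i.
  by move=> iM; apply: to_locK; apply: bernoulli_loc; lia.
have E : \sum_(i < M.+1) 'C(M.+1, i)%:R * to_loc 'F_p (bernoulli i) = (M == 0)%:R.
  apply/val_inj; rewrite rmorph_sum rmorph_nat -bernoulli_sum.
  apply: eq_bigr => i _; rewrite rmorphM rmorph_nat; congr (_ * _).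
  exact: locE.
have := congr1 (@loc_red 'F_p) E; rewrite rmorph_sum /= rmorph_nat => <-.
apply: eq_bigr => i _; rewrite rmorphM rmorph_nat; congr (_ * _).
exact: (congr1 (@ratr 'F_p) (esym (locE i (ltn_ord i)))).
Qed.

Lemma bernoulli_modE i : (i.+1 < p)%N -> reduce_mod p (bernoulli i) = bern_mod i.
Proof.
elim/ltn_ind: i => i IHi ip.
have := bernoulli_mod_sum ip; rewrite -(bern_mod_sum ip) !big_ord_recr /= binSn.
rewrite (eq_bigr (fun j : 'I_i => 'C(i.+1, j)%:R * bern_mod j)) => [|j _].
  by move/addrI/mulfI; apply; apply: Fp_natr_neq0; lia.
by rewrite IHi //; have := ltn_ord j; lia.
Qed.
End FpBernoulli.

(** * The sums W *)

Section AHmod.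
Variable p : nat.
Hypotheses (p_pr : prime p) (p_odd : odd p).
Let p1 : (1 < p)%N := prime_gt1 p_pr.
Local Notation N := (2 * p)%N.

Definition AH_loc (n : nat) : loc 'F_p := to_loc 'F_p (AH_coef p n).

Lemma val_AH_loc n : val (AH_loc n) = AH_coef p n.
Proof. exact/to_locK/AH_coef_loc. Qed.

Lemma AH_loc_red n : loc_red (AH_loc n) = AH_coef_mod p n.
Proof. exact: (congr1 (@ratr 'F_p) (val_AH_loc n)). Qed.

Lemma AH_loc_rec n :
  n%:R * AH_loc n = \sum_(j < n.+1) (ppow p j)%:R * AH_loc (n - j).
Proof.
apply/val_inj; rewrite rmorphM rmorph_nat rmorph_sum.
transitivity (n%:R * AH_coef p n); first by congr (_ * _); apply: val_AH_loc.
rewrite AH_rec //.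
apply: eq_bigr => j _; rewrite rmorphM rmorph_nat; congr (_ * _).
exact/esym/val_AH_loc.
Qed.

Definition AH_psect : {poly 'F_p} := \poly_(i < N) AH_coef_mod p (i * p).

Lemma AH_psect_ode :
  eqX N (theta AH_psect) (((ffremF p \Po - AH_dlog _ p) - 'X^(N.-1)) * AH_psect).
Proof.
have := @psect_ode (loc 'F_p) p (@loc_red 'F_p) AH_loc p_pr p_odd
  (loc_lreg (ltnW p1)) AH_loc_rec.
have -> // : map_poly (@loc_red 'F_p) (psect p AH_loc 0) = AH_psect.
apply/polyP=> i; rewrite coef_map !coef_poly; case: ifP => _; last exact: rmorph0.
by rewrite /psect_coef leq0n subn0 -AH_loc_red.
Qed.

(** The sign and the factor r in the definition of W are those of
    (theta a)(-X). *)
Lemma W_coefE k : (k < N)%N ->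
  W p k = (theta (AH_psect \Po - 'X) * AH_psect)`_k.
Proof.
move=> kN; rewrite coefM; apply: eq_bigr => i _.
have ik : (i <= k)%N by rewrite -ltnS.
rewrite coef_theta coef_comp_polyNX !coef_poly (leq_ltn_trans ik kN).
by rewrite (leq_ltn_trans (leq_subr _ _) kN); ring.
Qed.
End AHmod.

Theorem corollary1p5 (p k : nat) (p_prime : prime p) (p_odd : odd p)
    (k_range : (p <= k <= 2 * p - 1)%N) :
  W p k =
    if k == p then 0
    else if k == (2 * p - 1)%N then 1
    else (k - p)%N%:R / (k - p + 1)%N%:R * reduce_mod p (bernoulli (2 * p - 1 - k)).
Proof.
have p1 := prime_gt1 p_prime; have p3 := odd_prime_ge3 p_prime p_odd.
case/andP: k_range => pk kp; have kN : (k < 2 * p)%N by lia.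
have a0 : (AH_psect p)`_0 = 1.
  rewrite coef_poly muln_gt0 (ltnW p1) mul0n /AH_coef_mod AH_coef0.
  exact: (ratr_loc_int 'F_p 1).2.
rewrite W_coefE // (coef_thetaM_reflect p_prime p_odd a0 (AH_psect_ode p_prime p_odd)) ?pk //.
rewrite -(subn1 (2 * p)); case: (k =P p) => [->|kp1].
  have -> : (p == 2 * p - 1)%N = false by lia.
  by rewrite subnn mul0r addr0.
case: (k =P (2 * p - 1)%N) => [->|k2p].
  rewrite (_ : (2 * p - 1 - p + 1 = p)%N) ?nth_default ?mulr0 ?add0r //; last by lia.
  by apply: leq_trans (size_poly _ _) _; apply: size_ffrem.
rewrite addr0 bernoulli_modE ?bern_modS //; [|lia|lia].
have -> : (p - (2 * p - 1 - k) = k - p + 1)%N by lia.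
by rewrite mulrA divfK // Fp_natr_neq0 //; lia.
Qed.
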